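(* For every integer $g\ge 1$, the surgery-sum graph $\widehat{K}_g$ is connected.
   Context: $\Sigma_g$ denotes a closed oriented surface of genus $g\ge 1$. A collection $\Gamma$ of closed curves on $\Sigma_g$ in generic position (only transverse double points) is regarded as a 4-valent graph embedded in $\Sigma_g$: vertices are the intersection points, edges are the arcs between them. It is one-faced if $\Sigma_g\setminus\Gamma$ is a single open disk. Cutting $\Sigma_g$ along a one-faced $\Gamma$ gives a polygon $P_\Gamma$ with $8g-4$ sides; each edge of $\Gamma$ gives two sides, and the sides of $P_\Gamma$ are called the oriented edges of $\Gamma$ ($x$ and $\bar x$ denote the two sides of the same edge). Up to homeomorphism there is exactly one one-faced collection on the torus, denoted $\Gamma_{\mathbb T}$ (two simple closed curves meeting transversally once). Surgery: let $x,y$ be two oriented edges of a one-faced collection $\Gamma$ belonging to distinct edges of $\Gamma$. Let $\lambda_{x,y}$ be the simple arc, unique up to homotopy, whose interior is disjoint from $\Gamma$ (it lies in the interior of $P_\Gamma$) and which joins an interior point of the side $x$ to an interior point of the side $y$. The collection $\sigma_{x,y}(\Gamma)$ is obtained by cutting open $\Gamma$ along $\lambda_{x,y}$: remove from each of the two edges a small open subarc around the endpoint of $\lambda_{x,y}$, and join the four resulting ends by two disjoint parallel copies of $\lambda_{x,y}$, one on each side of $\lambda_{x,y}$. When $\sigma_{x,y}(\Gamma)$ is one-faced, the operation $\Gamma\to\sigma_{x,y}(\Gamma)$ is called a surgery. The surgery graph $K_g$ has as vertices the homeomorphism classes of one-faced collections on $\Sigma_g$; two distinct vertices are joined by an edge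 if they have representatives connected by a surgery. Connected sum: let $\Gamma_1,\Gamma_2$ be one-faced collections on $\Sigma_{g_1},\Sigma_{g_2}$, with oriented edges $x$ of $\Gamma_1$ and $y$ of $\Gamma_2$. Form the connected sum of surfaces $\Sigma_{g_1}\#\Sigma_{g_2}$ along open disks disjoint from $\Gamma_1$ and $\Gamma_2$; the complement of $\Gamma_1\cup\Gamma_2$ is an annulus. Take a simple arc $\lambda$ with interior in this annulus from the side $x$ to the side $y$ and contract it to a point. The resulting one-faced collection $(\Gamma_1\cup\Gamma_2\cup\lambda)/\lambda$ on a surface of genus $g_1+g_2$ is the connected sum $(\Gamma_1,x)\#(\Gamma_2,y)$. When $\Gamma_2=\Gamma_{\mathbb T}$ the result does not depend, up to homeomorphism, on the choice of $y$, and is written $(\Gamma_1,x)\#\Gamma_{\mathbb T}$. The surgery-sum graph $\widehat K_g$ is the disjoint union $\bigsqcup_{1\le i\le g}K_i$ together with an additional edge between (the classes of) $\Gamma_1\in K_i$ and $\Gamma_2\in K_{i+1}$, for $1\le i<g$, whenever $\Gamma_2$ is (up to homeomorphism) $(\Gamma_1,x)\#\Gamma_{\mathbb T}$ for some oriented edge $x$ of $\Gamma_1$. *)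

(* Defs.v *)
From mathcomp Require Import all_boot all_fingroup ssralg zmodp.
From Stdlib Require Import Relation_Operators Eqdep_dec.

Set Implicit Arguments.
Unset Strict Implicit.
Unset Printing Implicit Defensive.

Import GRing.Theory.

(** Cellularly embedded graphs on closed oriented surfaces are encoded, up to
    homeomorphism, by rotation systems on their half-edges.  A half-edge [h]
    also stands for the oriented edge leaving along [h], and for the side of
    the complementary polygon lying on the left of that oriented edge; [opp h]
    is then the other side of the same edge.
    A generic collection of curves is recovered from its 4-valent graph by
    going straight, from [h] to [rot (rot h)], at each vertex. *)

Record collection := Collection {
  half :> finType;
  rot : {perm half};   (* next half-edge counterclockwise at the same vertex *)
  opp : {perm half};   (* other half of the same edge *)
  rot4 : forall h, #|porbit rot h| = 4;
  oppK : involutive opp;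
  opp_neq : forall h, opp h != h
}.

Arguments rot {c}.
Arguments opp {c}.

(** The boundary of a face on the left of [h] turns, at the end of [h], to the
    half-edge which follows [opp h] clockwise. *)
Definition face (C : collection) : {perm C} := (opp * rot^-1)%g.

(** A single face forces the graph to be connected. *)
Definition one_faced (C : collection) : Prop := #|porbits (face C)| = 1.

(** The equation is [V - E + F = 2 - 2g]. *)
Definition one_faced_on (g : nat) (C : collection) : Prop :=
  one_faced C /\
  #|porbits (@rot C)| + #|porbits (face C)| + 2 * g = #|porbits (@opp C)| + 2.

(** Homeomorphisms may preserve or reverse the orientation. *)
Definition homeomorphic (C C' : collection) : Prop :=
  exists f : C -> C',
    [/\ bijective f, {morph f : h / opp h} &
        {morph f : h / rot h} \/ forall h, f (rot h) = (rot^-1)%g (f h)].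

Section CutOpen.
Variables (C : collection) (x y : C).

(** Let [x] run from [a] to [b] and [y] from [c] to [d].  Along the boundary of
    the polygon one reads [a b], then [c d], so the two parallel copies of an
    arc from [x] to [y] join [b] to [c] and [d] to [a].  Hence the edges
    [{x, opp x}] and [{y, opp y}] become [{x, opp y}] and [{y, opp x}], and
    the rotation at the vertices does not change. *)
Definition cut_opp : {perm C} := (opp ^ tperm (opp x) (opp y))%g.

Lemma cut_oppK : involutive cut_opp.
Proof.
move=> h; rewrite /cut_opp -permM -conjMg.
suff -> : (@opp C * opp)%g = 1%g by rewrite conj1g perm1.
by apply/permP=> z; rewrite permM perm1 oppK.
Qed.

Lemma cut_opp_neq h : cut_opp h != h.
Proof.
rewrite /cut_opp -[h](permKV (tperm (opp x) (opp y))) permJ.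
by rewrite (inj_eq perm_inj) opp_neq.
Qed.

Definition cut_open : collection := Collection (@rot4 C) cut_oppK cut_opp_neq.

Definition is_surgery : Prop :=
  [/\ y != x, y != opp x & one_faced cut_open].

End CutOpen.

Lemma porbit4 (T : finType) (s : {perm T}) (x : T) :
  s (s (s (s x))) = x -> s (s x) != x -> #|porbit s x| = 4.
Proof.
move=> s4 s2.
have s1 : s x != x by apply: contra s2 => /eqP e; rewrite !e.
have s3 : s (s (s x)) != x.
  by apply: contra s1 => /eqP e; rewrite -{2}s4 e.
have -> : porbit s x = [set:: [:: x; s x; s (s x); s (s (s x))]].
  apply/setP=> z; rewrite inE; apply/porbitP/idP.
    case=> i ->; elim: i => [|i IH]; first by rewrite expg0 perm1 mem_head.
    rewrite expgSr permM; move: IH; rewrite !inE.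
    by case/or4P=> /eqP ->; rewrite ?s4 eqxx ?orbT.
  rewrite !inE; case/or4P=> /eqP ->; [exists 0|exists 1|exists 2|exists 3];
  by rewrite ?permX.
rewrite cardsE; apply/eqP.
have /card_uniqP -> // : uniq [:: x; s x; s (s x); s (s (s x))].
by rewrite /= !inE !(inj_eq perm_inj) !negb_or !(eq_sym x) s1 s2 s3.
Qed.

Section ConnectedSum.
Variables (C1 C2 : collection) (x : C1) (y : C2).

(** With [x] running from [a] to [b] and [y] from [c] to [d], contracting an
    arc from [x] to [y] which lies on the left of both yields a vertex with
    half-edges [0, 1, 2, 3] towards [a, b, c, d], in counterclockwise order. *)
Definition csum_half : finType := (C1 + C2 + 'I_4)%type.

Definition csum_opp_fun (h : csum_half) : csum_half :=
  match h with
  | inl (inl u) => if u == x then inr (inord 0)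
                   else if u == opp x then inr (inord 1)
                   else inl (inl (opp u))
  | inl (inr v) => if v == y then inr (inord 2)
                   else if v == opp y then inr (inord 3)
                   else inl (inr (opp v))
  | inr i => tnth [tuple inl (inl x); inl (inl (opp x));
                         inl (inr y); inl (inr (opp y))] i
  end.

Definition csum_rot_fun (h : csum_half) : csum_half :=
  match h with
  | inl (inl u) => inl (inl (rot u))
  | inl (inr v) => inl (inr (rot v))
  | inr i => inr (i + 1)%R
  end.

Lemma csum_opp_funK : involutive csum_opp_fun.
Proof.
case=> [[u|v]|i] /=.
- case: ifP => [/eqP ->|ux].
    by rewrite /= (tnth_nth (inr ord0)) inordK.
  case: ifP => [/eqP ->|uox].
    by rewrite /= (tnth_nth (inr ord0)) inordK.
  rewrite /= (inj_eq (can_inj (@oppK C1))) (can2_eq (@oppK C1) (@oppK C1)).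
  by rewrite ux uox oppK.
- case: ifP => [/eqP ->|vy].
    by rewrite /= (tnth_nth (inr ord0)) inordK.
  case: ifP => [/eqP ->|voy].
    by rewrite /= (tnth_nth (inr ord0)) inordK.
  rewrite /= (inj_eq (can_inj (@oppK C2))) (can2_eq (@oppK C2) (@oppK C2)).
  by rewrite vy voy oppK.
- rewrite (tnth_nth (inr ord0)); case: i => [[|[|[|[|//]]]] lti] /=;
    rewrite ?eqxx ?(negPf (opp_neq _)); congr inr; apply: val_inj;
    by rewrite /= inordK.
Qed.

Lemma csum_rot_fun_inj : injective csum_rot_fun.
Proof.
move=> [[u|v]|i] [[u'|v']|i'] //= [].
- by move/perm_inj=> ->.
- by move/perm_inj=> ->.
- by move=> e; congr inr; apply: (@addIr _ 1%R); apply: val_inj.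
Qed.

Definition csum_opp : {perm csum_half} := perm (inv_inj csum_opp_funK).
Definition csum_rot : {perm csum_half} := perm csum_rot_fun_inj.

Lemma csum_rot4 h : #|porbit csum_rot h| = 4.
Proof.
have H (C : collection) (u : C) :
    rot (rot (rot (rot u))) = u /\ rot (rot u) != u.
  have := iter_porbit rot u; have := uniq_traject_porbit rot u.
  by rewrite rot4 /= !inE !negb_or => /andP[/and3P[_ h2 _] _] h4; rewrite eq_sym.
apply: porbit4; rewrite !permE; case: h => [[u|v]|i] //=.
- by rewrite (H _ u).1.
- by rewrite (H _ v).1.
- by congr inr; case: i => [[|[|[|[|//]]]] lti]; apply: val_inj.
- by have [_] := H _ u; apply: contra => /eqP[->].
- by have [_] := H _ v; apply: contra => /eqP[->].
- by case: i => [[|[|[|[|//]]]] lti].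
Qed.

Lemma csum_oppK : involutive csum_opp.
Proof. by move=> h; rewrite !permE csum_opp_funK. Qed.

Lemma csum_opp_neq h : csum_opp h != h.
Proof.
rewrite permE; case: h => [[u|v]|i] /=.
- case: ifP => // _; case: ifP => // _.
  by apply/eqP=> -[/eqP]; rewrite (negPf (opp_neq u)).
- case: ifP => // _; case: ifP => // _.
  by apply/eqP=> -[/eqP]; rewrite (negPf (opp_neq v)).
- by rewrite (tnth_nth (inr ord0)); case: i => [[|[|[|[|//]]]] lti].
Qed.

Definition connected_sum : collection :=
  Collection csum_rot4 csum_oppK csum_opp_neq.

End ConnectedSum.

Definition torus_rot : {perm 'I_4} := perm (addIr (1 : 'I_4)%R).
Definition torus_opp : {perm 'I_4} := perm (addIr (2%:R : 'I_4)%R).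

Lemma torus_rot4 h : #|porbit torus_rot h| = 4.
Proof.
apply: porbit4; rewrite !permE; case: h => [[|[|[|[|//]]]] lti] //;
  exact: val_inj.
Qed.

Lemma torus_oppK : involutive torus_opp.
Proof.
by move=> h; rewrite !permE; case: h => [[|[|[|[|//]]]] lti]; apply: val_inj.
Qed.

Lemma torus_opp_neq h : torus_opp h != h.
Proof. by rewrite permE; case: h => [[|[|[|[|//]]]] lti]. Qed.

Definition torus_collection : collection :=
  Collection torus_rot4 torus_oppK torus_opp_neq.

Record graph := Graph {
  vertex : Type;
  adj : vertex -> vertex -> Prop;
  adj_sym : forall u v, adj u v -> adj v u;
  adj_irrefl : forall u, ~ adj u u
}.

Definition connected (G : graph) : Prop :=
  inhabited (vertex G) /\
  forall u v : vertex G, clos_refl_trans (vertex G) (@adj G) u v.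

Definition homeo_class (g : nat) : Type :=
  {c : collection -> Prop |
    exists C, one_faced_on g C /\ c = homeomorphic C}.

Definition represents (g : nat) (C : collection) (u : homeo_class g) : Prop :=
  proj1_sig u C.

Definition surgery_related (g : nat) (u v : homeo_class g) : Prop :=
  exists (C : collection) (x y : C),
    [/\ represents C u, is_surgery x y & represents (cut_open x y) v].

Definition K_adj (g : nat) (u v : homeo_class g) : Prop :=
  u <> v /\ (surgery_related u v \/ surgery_related v u).

Lemma K_adj_sym g (u v : homeo_class g) : K_adj u v -> K_adj v u.
Proof. by case=> n o; split; [apply: not_eq_sym | case: o; [right|left]]. Qed.

Lemma K_adj_irrefl g (u : homeo_class g) : ~ K_adj u u.
Proof. by case. Qed.

Definition surgery_graph (g : nat) : graph :=
  Graph (@K_adj_sym g) (@K_adj_irrefl g).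

Definition torus_sum_related (g g' : nat)
    (u : homeo_class g) (v : homeo_class g') : Prop :=
  exists (C : collection) (x : C) (y : torus_collection),
    represents C u /\ represents (connected_sum x y) v.

(** The index [i : 'I_g] corresponds to the genus [i.+1], so that the genus
    ranges over [1, ..., g]. *)
Definition hatK_vertex (g : nat) : Type :=
  {i : 'I_g & vertex (surgery_graph i.+1)}.

Inductive hatK_adj (g : nat) : hatK_vertex g -> hatK_vertex g -> Prop :=
| hatK_surgery (i : 'I_g) (u v : vertex (surgery_graph i.+1)) :
    adj u v -> hatK_adj (existT _ i u) (existT _ i v)
| hatK_sum (i j : 'I_g) (u : vertex (surgery_graph i.+1))
    (v : vertex (surgery_graph j.+1)) :
    j = i.+1 :> nat -> torus_sum_related u v ->
    hatK_adj (existT _ i u) (existT _ j v)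
| hatK_sum_sym (i j : 'I_g) (u : vertex (surgery_graph i.+1))
    (v : vertex (surgery_graph j.+1)) :
    j = i.+1 :> nat -> torus_sum_related u v ->
    hatK_adj (existT _ j v) (existT _ i u).

Lemma hatK_adj_sym g (u v : hatK_vertex g) : hatK_adj u v -> hatK_adj v u.
Proof.
case=> [i a b /adj_sym ab|i j a b ij ab|i j a b ij ab].
- exact: hatK_surgery.
- exact: hatK_sum_sym.
- exact: hatK_sum.
Qed.

Lemma hatK_adj_irrefl g (u : hatK_vertex g) : ~ hatK_adj u u.
Proof.
have H v w : @hatK_adj g v w -> v <> w.
  case=> [i a b ab|i j a b ij _|i j a b ij _] e.
  - have eab : a = b.
      by apply: inj_pair2_eq_dec e => p q; case: (p =P q); [left|right].
    by apply: (@adj_irrefl _ a); rewrite {2}eab.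
  - by have /(congr1 val)/= := projT1_eq e; rewrite ij => /n_Sn.
  - by have /(congr1 val)/= := projT1_eq e; rewrite ij => /esym/n_Sn.
by move/H.
Qed.

Definition surgery_sum_graph (g : nat) : graph :=
  Graph (@hatK_adj_sym g) (@hatK_adj_irrefl g).

(* Main.v *)
(** Cut the surface along a one-faced collection, and read the sides of the
    polygon as a cyclic word in which each edge is a chord.  Cutting open along
    an arc between two disjoint chords [x x'] and [y y'] keeps one face; its
    effect on [x A x' B y D y' E] is to exchange [A] and [D].  In genus at
    least 2 such moves lead to a connected sum with the torus, and the theorem
    follows by induction on the genus.

    First make an edge join opposite ends [a] and [rot (rot a)] of a vertex.
    If the four corners of some vertex do not appear on the word in one of the
    two cyclic orders of the vertex, one surgery does it.  If they do, then
    some surgery breaks this order, unless the four arcs of the word between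
    the corners are so isolated that a neighbouring vertex is in the good case
    (counterclockwise order) or that the vertex carries a bridge, which parity
    forbids in a 4-valent graph (clockwise order).

    The word now reads [c a c' U d a' d' V].  A chord which joins the first
    letter of [U] to another letter of [U] allows a surgery which empties [U],
    as does a chord at the last letter, and at most one surgery is needed to
    create such a chord in [U] or in [V].  A factor [c a c' d a' d'] comes from
    a torus summand. *)

From Stdlib Require Import Relation_Operators.
From Stdlib Require Import Classical FunctionalExtensionality.
From Stdlib Require Import PropExtensionality.
From mathcomp Require Import all_boot all_fingroup ssralg zmodp ring zify.
Require Import Defs.

Set Implicit Arguments.
Unset Strict Implicit.
Unset Printing Implicit Defensive.

(** * Face words and surgeries *)

Section FaceWords.
Variables (T : finType) (R : {perm T}).
Implicit Types (O : {perm T}) (s A B D E : seq T).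

(** On the boundary of a face, [v] comes right after [u]; this is
    [face u = v] freed from inverses. *)
Definition follows (O : T -> T) : rel T := fun u v => R v == O u.

(** A closed word through all half-edges means that there is a single face. The conditions on [O]
    are bundled in because each surgery replaces [O]. *)
Definition face_word O s : Prop :=
  [/\ involutive O, forall h, O h != h, uniq s, forall h, h \in s
    & path.cycle (follows O) s].

Lemma face_wordC O A B : face_word O (A ++ B) -> face_word O (B ++ A).
Proof.
case=> OK On us sT cs; split=> // [|h|].
- by rewrite uniq_catC.
- by rewrite mem_cat orbC -mem_cat.
- by rewrite -rot_size_cat rot_cycle.
Qed.

Lemma face_word_from O s h : face_word O s -> exists s', face_word O (h :: s').
Proof.
move=> W; have [_ _ _ /(_ h)/path.splitPr H _] := W.
by case: H W => A B /face_wordC W; exists (B ++ A).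
Qed.

Lemma face_word_next O A u v B : face_word O (A ++ u :: v :: B) -> R v = O u.
Proof. by case/face_wordC => _ _ _ _ /= /andP[/eqP]. Qed.

Lemma face_word_last O h s v B :
  face_word O (h :: s ++ v :: B) -> R v = O (last h s).
Proof.
by case=> _ _ _ _ /=; rewrite rcons_cat cat_path /= => /and3P[_ /eqP].
Qed.

Lemma face_word_wrap O h s : face_word O (h :: s) -> R h = O (last h s).
Proof. by case=> _ _ _ _ /=; rewrite rcons_path => /andP[_ /eqP]. Qed.

Lemma face_word_succ O A u B E v :
    face_word O (A ++ u :: B ++ E) -> v \in u :: B -> v != last u B ->
  exists2 w, w \in B & R w = O v.
Proof.
move=> W vB; case/path.splitPl: vB W => B1 B2 <-.
case: B2 => [|w B2]; first by rewrite cats0 eqxx.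
move=> W _; exists w; first by rewrite mem_cat mem_head orbT.
have {W}: face_word O ((A ++ u :: B1) ++ w :: B2 ++ E).
  by move: W; rewrite -!catA.
by move/face_wordC/face_word_wrap; rewrite !last_cat.
Qed.

(** Otherwise [h] would follow itself on the face, so the word would consist of [h] alone and miss
    [O h]. *)
Lemma opp_neq_rot O s h : face_word O s -> O h != R h.
Proof.
case/(@face_word_from _ _ h)=> {}s W; apply/eqP=> e.
case: s W => [|v s] W.
  by case: W => _ /(_ h)/eqP n _ /(_ (O h)); rewrite inE => /eqP.
have := @face_word_next _ [::] _ _ _ W; rewrite e => /perm_inj vh.
by case: W => _ _ /=; rewrite vh inE eqxx.
Qed.

(** Here [O] varies while the rotation [R] is fixed, as surgeries do not change
    it. *)
Definition cut O x y : {perm T} := (O ^ tperm (O x) (O y))%g.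

Lemma cutE O x y h :
  cut O x y h = tperm (O x) (O y) (O (tperm (O x) (O y) h)).
Proof. by rewrite /cut conjgE !permM tpermV. Qed.

Lemma cutC O x y : cut O x y = cut O y x.
Proof. by rewrite /cut tpermC. Qed.

Lemma cutK O x y : involutive O -> involutive (cut O x y).
Proof. by move=> OK h; rewrite !cutE tpermK OK tpermK. Qed.

Lemma cut_neq O x y : (forall h, O h != h) -> forall h, cut O x y h != h.
Proof.
move=> On h; rewrite cutE -[X in _ != X](tpermK (O x) (O y)).
by rewrite (inj_eq perm_inj).
Qed.

Lemma cutL O x y : involutive O -> (forall h, O h != h) -> y != O x ->
  cut O x y x = O y.
Proof.
move=> OK On yox; rewrite cutE [tperm _ _ x]tpermD ?tpermL //.
by apply: contra yox => /eqP <-; rewrite OK.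
Qed.

Lemma cutR O x y : involutive O -> (forall h, O h != h) -> y != O x ->
  cut O x y y = O x.
Proof.
by move=> OK On yox; rewrite cutC cutL // -(inj_eq (inv_inj OK)) OK eq_sym.
Qed.

Lemma cut_id O x y h :
  h \notin [:: x; O x; y; O y] -> cut O x y h = O h.
Proof.
rewrite !inE !negb_or !(eq_sym h) => /and4P[hx hox hy hoy].
by rewrite cutE [tperm _ _ h]tpermD ?tpermD ?(inj_eq perm_inj).
Qed.

Lemma cycle_arcs (e : rel T) x A x' B y D y' E :
  path.cycle e (x :: A ++ x' :: B ++ y :: D ++ y' :: E) =
  [&& path e x (rcons A x'), path e x' (rcons B y),
      path e y (rcons D y') & path e y' (rcons E x)].
Proof.
by do 3!rewrite /= rcons_cat cat_path; rewrite /= !rcons_path -!andbA.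
Qed.

(** The pairing matters only at the letters that a path leaves, never at its last one. An arc can
    therefore be attached to a new first letter [u'] with [O' u' = O u]. *)
Lemma eq_arc (O O' : T -> T) u u' s v :
    O' u' = O u -> {in s, O' =1 O} ->
  path (follows O') u' (rcons s v) = path (follows O) u (rcons s v).
Proof.
elim: s u u' => [|w s IH] u u' eu es /=; rewrite /follows eu //.
congr (_ && _); apply: IH => [|h hs]; apply: es; rewrite inE ?eqxx //.
by rewrite hs orbT.
Qed.

(** What follows a letter on the face is determined by its partner. The cut makes [x] and [y] swap
    partners, and also [O x] and [O y]. So [A] and [D] change places, [B] now follows [O y] and [E]
    follows [O x], which again closes up to one word. *)
Lemma face_word_cut O x y A B D E :
    face_word O (x :: A ++ O x :: B ++ y :: D ++ O y :: E) ->
  [/\ y != x /\ y != O x,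
      face_word (cut O x y) (x :: D ++ O y :: B ++ y :: A ++ O x :: E),
      cut O x y x = O y, cut O x y y = O x &
      {in A ++ B ++ D ++ E, cut O x y =1 O}].
Proof.
set s := x :: A ++ _ => W; have [OK On us sT] := W.
rewrite cycle_arcs => /and4P[ca cb cd ce].
pose c := [:: x; O x; y; O y]; pose r := A ++ B ++ D ++ E.
have sE : perm_eq s (c ++ r).
  by apply/seq.permP=> a; do 4!rewrite /s /c /r /= ?count_cat; ring.
have [nyx nyox rc] : [/\ y != x, y != O x & {in r, forall h, h \notin c}].
  move: us; rewrite (perm_uniq sE) cat_uniq => /and3P[/= uc /hasPn rc _].
  move: uc; rewrite !inE !negb_or !(eq_sym _ y).
  by case/and4P=> /and3P[_ ? _] /andP[? _] _ _; split=> // h /rc.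
have cx : cut O x y x = O y by apply: cutL.
have cy : cut O x y y = O x by apply: cutR.
have cox : cut O x y (O x) = y by rewrite -cy cutK.
have coy : cut O x y (O y) = x by rewrite -cx cutK.
split=> //; last by move=> h /rc/cut_id.
split; [exact: cutK | exact: cut_neq | | |].
- rewrite -(perm_uniq (s1 := s)) //; apply/seq.permP=> a.
  by do 4!rewrite /s /= ?count_cat; ring.
- move=> h; have := sT h; rewrite (perm_mem (s2 := s)) //; apply/seq.permP=> a.
  by do 4!rewrite /s /= ?count_cat; ring.
have eqc p : {subset p <= r} -> {in p, cut O x y =1 O}.
  by move=> pr h /pr/rc/cut_id.
have [sA sB] : {subset A <= r} /\ {subset B <= r}.
  by split=> h hp; rewrite !mem_cat hp ?orbT.
have [sD sE'] : {subset D <= r} /\ {subset E <= r}.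
  by split=> h hp; rewrite !mem_cat hp ?orbT.
rewrite cycle_arcs; apply/and4P; split.
- by rewrite (@eq_arc O _ y) //; apply: eqc.
- by rewrite (@eq_arc O _ (O x)) ?coy ?OK //; apply: eqc.
- by rewrite (@eq_arc O _ x) //; apply: eqc.
- by rewrite (@eq_arc O _ (O y)) ?cox ?OK //; apply: eqc.
Qed.

Inductive reach (Q : {perm T} -> Prop) O : Prop :=
| reach_here of Q O
| reach_cut x y of y != x & y != O x & (exists s, face_word (cut O x y) s)
    & reach Q (cut O x y).

Lemma reach_trans (Q Q' : {perm T} -> Prop) O :
  reach Q O -> (forall O', Q O' -> reach Q' O') -> reach Q' O.
Proof.
move=> rO QQ'; elim: rO => {}O; first exact: QQ'.
by move=> x y *; apply: (@reach_cut _ _ x y).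
Qed.

Lemma reach_face_word_cut Q O x y A B D E :
    face_word O (x :: A ++ O x :: B ++ y :: D ++ O y :: E) ->
  reach Q (cut O x y) -> reach Q O.
Proof.
move=> /face_word_cut[[yx yox] W' _ _ _]; apply: (reach_cut yx yox).
by eexists; apply: W'.
Qed.

Hypothesis R4 : forall h, R (R (R (R h))) = h.
Hypothesis R2 : forall h, R (R h) != h.

Definition catE := (=^~ @cats1 T, =^~ @catA T, @cat_cons T, @cat0s T, @cats0 T).

Ltac rotate_word p q W :=
  have := @face_wordC _ p q; move: W; rewrite ?catE => W; exact.

(** * Creating an edge between opposite ends of a vertex *)

Definition has_loop O : Prop :=
  exists s h, face_word O s /\ O h = R (R h).

(** The letter before [a] is the partner of [R a], and the letter before [R (R a)] that of
    [R (R (R a))]. In this order of the corners the two chords are disjoint, and cutting them open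
    pairs [R (R (R a))] with its opposite [R a]. *)
Lemma reach_loop_mixed O a A B D E :
  face_word O (a :: A ++ R a :: B ++ R (R (R a)) :: D ++ R (R a) :: E) ->
  reach has_loop O.
Proof.
move=> W; have [OK On _ _ _] := W.
(* An empty [E] would make [R a] and [R (R a)] partners, and an empty [D] would make [R (R (R a))]
   its own partner. *)
case/lastP: E W => [|E o1] W.
  have /= := face_word_wrap W; rewrite !(last_cat, last_cons) /= => e.
  by have /eqP[] := opp_neq_rot (R a) W; rewrite {1}e OK.
case/lastP: D W => [|D o3] W.
  have := @face_word_next O (a :: A ++ R a :: B) (R (R (R a)))
    (R (R a)) (rcons E o1).
  move: W; rewrite ?catE => W /(_ W)/esym/eqP.
  by rewrite (negPf (On _)).
have e1 : O o1 = R a.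
  by rewrite (face_word_wrap W) !(last_cat, last_cons, last_rcons).
have e3 : o3 = O (R (R (R a))).
  have := @face_word_next O (a :: A ++ R a :: B ++ R (R (R a)) :: D) o3.
  by move/(_ (R (R a)) (rcons E o1)); move: W; rewrite ?catE => W /(_ W) ->.
have {}W : face_word O (o1 :: (a :: A) ++ O o1 :: B ++ R (R (R a)) :: D
                           ++ O (R (R (R a))) :: (R (R a) :: E)).
  rewrite e1 -e3.
  rotate_word (a :: A ++ R a :: B ++ R (R (R a)) :: D ++ o3 :: R (R a) :: E)
    [:: o1] W.
apply: (reach_face_word_cut W); apply: reach_here.
have [_ W' _ cy _] := face_word_cut W.
eexists; exists (R (R (R a))); split; first exact: W'.
by rewrite cy e1 R4.
Qed.

Lemma face_word_pred O A h s v B :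
    face_word O (A ++ h :: s ++ v :: B) -> O (R v) != h ->
  exists s', s = rcons s' (O (R v)).
Proof.
move=> W; have [OK _ _ _ _] := W.
case/lastP: s W => [|s u] W n; last first.
  exists s; congr rcons; apply: (can_inj OK); rewrite OK; apply/esym.
  have := @face_word_next O (A ++ h :: s) u v B.
  by move: W; rewrite ?catE => W; apply.
by rewrite (face_word_next W) OK eqxx in n.
Qed.

Lemma split_chord O s p : p != O p -> involutive O -> p \in s -> O p \in s ->
  exists q X Y Z, s = X ++ q :: Y ++ O q :: Z.
Proof.
move=> np OK /path.splitPr[X Y]; rewrite mem_cat inE eq_sym (negPf np) /=.
case/orP=> /path.splitPr[Z U].
  by exists (O p), Z, U, Y; rewrite OK -catA.
by exists p, X, Z, U.
Qed.

(** [S0] ends with [O a], so the chord of [a] encloses no other corner and is disjoint from the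
    chord of [p]. Exchanging their insides carries the one or two corners enclosed by the latter
    past the others, and the order becomes mixed. *)
Lemma clockwise_chord_reach_loop O a S0 S1 S2 S3 p :
    face_word O (a :: S0 ++ R (R (R a)) :: S3 ++ R (R a) :: S2 ++ R a :: S1) ->
    [|| (p \in S3) && (O p \in S2), (p \in S3) && (O p \in S1)
      | (p \in S2) && (O p \in S1)] ->
  reach has_loop O.
Proof.
move=> W; have [OK On _ _ _] := W.
have [S e0] : exists S, S0 = rcons S (O a).
  by rewrite -[a]R4; apply: (face_word_pred (A := [::]) W); rewrite R4.
case/or3P=> /andP[/path.splitPr e1 /path.splitPr e2];
  case: e1 e2 W => X Y [Z U] W.
- have {}W : face_word O (a :: S ++ O a :: (R (R (R a)) :: X) ++ p ::
      (Y ++ R (R a) :: Z) ++ O p :: (U ++ R a :: S1)).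
    by move: W; rewrite e0 ?catE.
  apply: (reach_face_word_cut W); have [_ {}W _ _ _] := face_word_cut W.
  apply: (@reach_loop_mixed _ (R (R a)) (Z ++ [:: O p])
    (X ++ p :: S ++ O a :: U) S1 Y); rewrite !R4.
  rotate_word (a :: Y) (R (R a) :: Z ++ O p :: R (R (R a)) :: X ++ p ::
    S ++ O a :: U ++ R a :: S1) W.
- have {}W : face_word O (a :: S ++ O a :: (R (R (R a)) :: X) ++ p ::
      (Y ++ R (R a) :: S2 ++ R a :: Z) ++ O p :: U).
    by move: W; rewrite e0 ?catE.
  apply: (reach_face_word_cut W); have [_ {}W _ _ _] := face_word_cut W.
  apply: (@reach_loop_mixed _ (R (R (R a))) (X ++ p :: S ++ O a :: U)
     Y S2 (Z ++ [:: O p])); rewrite !R4.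
  rotate_word (a :: Y ++ R (R a) :: S2 ++ R a :: Z ++ [:: O p])
    (R (R (R a)) :: X ++ p :: S ++ O a :: U) W.
- have {}W : face_word O (a :: S ++ O a :: (R (R (R a)) :: S3 ++ R (R a) :: X)
      ++ p :: (Y ++ R a :: Z) ++ O p :: U).
    by move: W; rewrite e0 ?catE.
  apply: (reach_face_word_cut W); have [_ {}W _ _ _] := face_word_cut W.
  apply: (@reach_loop_mixed _ a Y (Z ++ [:: O p]) S3 (X ++ p :: S ++ O a :: U)).
  by move: W; rewrite ?catE.
Qed.

(** Unless the edge of [a] is already a loop, [O a] ends [S2], so going on from [O a] to [a] one
    meets only the corner [R (R (R a))]. Exchanging this stretch with the inside of a chord given by
    [p] makes the order mixed. *)
Lemma counterclockwise_chord_reach_loop O a S0 S1 S2 S3 p :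
    face_word O (a :: S0 ++ R a :: S1 ++ R (R a) :: S2 ++ R (R (R a)) :: S3) ->
    (p \in S0) || (p \in S1) -> O p \in S1 ->
  reach has_loop O.
Proof.
move=> W; have [OK On _ _ _] := W.
have [loop|nloop] := eqVneq (O a) (R (R a)).
  by move=> _ _; apply: reach_here; eexists; exists a; split; first exact: W.
have [S e2] : exists S, S2 = rcons S (O a).
  rewrite -[a]R4.
  apply: (@face_word_pred O (a :: S0 ++ R a :: S1) (R (R a)) _ _ S3).
    by move: W; rewrite ?catE.
  by rewrite R4.
case/orP=> [pS0|pS1] opS1.
- case/path.splitPr: pS0 W => X Y; case/path.splitPr: opS1 => Z U W.
  have {}W : face_word O (O a :: (R (R (R a)) :: S3) ++ O (O a) :: X ++ p ::
      (Y ++ R a :: Z) ++ O p :: (U ++ R (R a) :: S)).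
    move: W; rewrite OK e2 => W.
    rotate_word (a :: X ++ p :: Y ++ R a :: Z ++ O p :: U ++
      R (R a) :: S) (O a :: R (R (R a)) :: S3) W.
  apply: (reach_face_word_cut W); have [_ {}W _ _ _] := face_word_cut W.
  rewrite OK in W.
  apply: (@reach_loop_mixed _ (R (R (R a))) S3 U
    (S ++ O a :: Y) (Z ++ O p :: X ++ [:: p])); rewrite !R4.
  rotate_word (O a :: Y ++ R a :: Z ++ O p :: X ++ [:: p])
    (R (R (R a)) :: S3 ++ a :: U ++ R (R a) :: S) W.
- have [q [X [Y [Z e1]]]] : exists q X Y Z, S1 = X ++ q :: Y ++ O q :: Z.
    by apply: split_chord pS1 opS1; rewrite // eq_sym.
  have {}W : face_word O (O a :: (R (R (R a)) :: S3) ++ O (O a) ::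
      (S0 ++ R a :: X) ++ q :: Y ++ O q :: (Z ++ R (R a) :: S)).
    move: W; rewrite OK e2 e1 => W.
    rotate_word (a :: S0 ++ R a :: X ++ q :: Y ++ O q :: Z ++
      R (R a) :: S) (O a :: R (R (R a)) :: S3) W.
  apply: (reach_face_word_cut W); have [_ {}W _ _ _] := face_word_cut W.
  rewrite OK in W.
  apply: (@reach_loop_mixed _ (R (R (R a))) S3 Z
    (S ++ O a :: Y ++ O q :: S0) (X ++ [:: q])); rewrite !R4.
  rotate_word (O a :: Y ++ O q :: S0 ++ R a :: X ++ [:: q])
    (R (R (R a)) :: S3 ++ a :: Z ++ R (R a) :: S) W.
Qed.

Lemma even_card_closed (f : T -> T) (A : {pred T}) :
    involutive f -> (forall h, f h != h) -> {in A, forall h, f h \in A} ->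
  ~~ odd #|A|.
Proof.
move=> fK fn fA; rewrite -(@fcard_order_set _ f (inv_inj fK) 2) //.
- by rewrite oddM andbF.
- apply/subsetP=> h _; rewrite inE; apply/eqP.
  apply: (@order_cycle _ _ [:: h; f h]); rewrite /= ?inE ?fK ?eqxx //.
  by rewrite eq_sym fn.
- move=> h _ /eqP <-; apply/idP/idP; first exact: fA.
  by move/fA; rewrite fK.
Qed.

Lemma uniq_cat_disjoint (A B : seq T) h :
  uniq (A ++ B) -> h \in A -> h \in B -> False.
Proof. by rewrite cat_uniq => /and3P[_ /hasPn d _] hA /d /=; rewrite hA. Qed.

Ltac mem_twice A B h us hA hB :=
  have := @uniq_cat_disjoint A B h; rewrite ?catE => /(_ us);
  rewrite !(inE, mem_cat) hA ?hB ?eqxx ?orbT; by move/(_ isT isT).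

Lemma face_word_mem_pred O A u B E v :
    face_word O (A ++ u :: B ++ E) -> v \in B ->
  exists2 w, w \in u :: B & R v = O w.
Proof.
move=> W vB; case/path.splitPr: vB W => B1 B2 W.
exists (last u B1).
  by have := mem_last u B1; rewrite !inE mem_cat => /orP[->|->]; rewrite ?orbT.
have {}W : face_word O (u :: B1 ++ v :: (B2 ++ E ++ A)).
  rotate_word A (u :: B1 ++ v :: (B2 ++ E)) W.
exact: face_word_last W.
Qed.

Lemma clockwise_rot O a S0 S1 S2 S3 (b := R (R (R a))) :
    face_word O (a :: S0 ++ R (R (R a)) :: S3 ++ R (R a) :: S2 ++ R a :: S1) ->
  face_word O (b :: S3 ++ R (R (R b)) :: S2 ++ R (R b) :: S1 ++ R b :: S0).
Proof.
move=> W; rewrite /b !R4.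
rotate_word (a :: S0) (R (R (R a)) :: S3 ++ R (R a) :: S2 ++ R a :: S1) W.
Qed.

Lemma clockwise_mem O a S0 S1 S2 S3 :
    face_word O (a :: S0 ++ R (R (R a)) :: S3 ++ R (R a) :: S2 ++ R a :: S1) ->
  O a \in S0.
Proof.
move=> W; have [_ On _ _ _] := W.
case: (@face_word_pred _ [::] _ _ _ _ W); rewrite R4 // => s ->.
by rewrite mem_rcons mem_head.
Qed.

(** If no edge leads from [S3] to another arc, then [R (R (R a)) :: S3] is a union of edges and [S3]
    a union of vertices. Both lengths would be even, yet they differ by one. *)
Lemma reach_loop_of_clockwise O a S0 S1 S2 S3 :
    face_word O (a :: S0 ++ R (R (R a)) :: S3 ++ R (R a) :: S2 ++ R a :: S1) ->
  reach has_loop O.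
Proof.
move=> W; have [OK On us sT _] := W.
have W3 := clockwise_rot W; have W2 := clockwise_rot W3.
have W1 := clockwise_rot W2.
have := clockwise_mem W1; have := clockwise_mem W2; have := clockwise_mem W3.
have := clockwise_mem W; rewrite !R4 => m0 m3 m2 m1.
have [/allP c|/allPn[p pS3 nOp]] :=
    boolP (all (fun p => O p \in R (R (R a)) :: S3) S3); last first.
  have : O p \in [:: a; R (R a); R a] \/ O p \in S2 ++ S1 ++ S0.
    apply/orP; rewrite -mem_cat; move: (sT (O p)) nOp.
    rewrite !(inE, mem_cat).
    by do 4?case: (_ == _) => //=; do 4?case: (_ \in _) => //=.
  case.
    rewrite !inE => /or3P[] /eqP e; exfalso; move: pS3; rewrite -[p]OK e => pS3.
    - mem_twice (a :: S0) (R (R (R a)) :: S3 ++ R (R a) :: S2 ++ R a :: S1)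
        (O a) us m0 pS3.
    - mem_twice (a :: S0 ++ R (R (R a)) :: S3) (R (R a) :: S2 ++ R a :: S1)
        (O (R (R a))) us pS3 m2.
    - mem_twice (a :: S0 ++ R (R (R a)) :: S3) (R (R a) :: S2 ++ R a :: S1)
        (O (R a)) us pS3 m1.
  rewrite !mem_cat => /or3P[] m.
  - by apply: (clockwise_chord_reach_loop (p := p) W); rewrite pS3 m.
  - by apply: (clockwise_chord_reach_loop (p := p) W); rewrite pS3 m orbT.
  - apply: (clockwise_chord_reach_loop (p := O p) W2).
    by rewrite OK m pS3 !orbT.
(* The edge at [R (R (R a))] would be a bridge. *)
exfalso; have size_mem s : uniq s -> #|[in s]| = size s by move/card_uniqP.
have [u3 u3'] : uniq (R (R (R a)) :: S3) /\ uniq S3.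
  suff u : uniq (R (R (R a)) :: S3) by split=> //; case/andP: u.
  move: us; rewrite -cat_cons cat_uniq => /and3P[_ _].
  by rewrite -cat_cons cat_uniq => /and3P[].
have /negP[] : ~~ odd #|[in R (R (R a)) :: S3]|.
  apply: (@even_card_closed O) => // h; rewrite !inE => /predU1P[->|/c//].
  by rewrite m3 orbT.
have : ~~ odd #|[in S3]|.
  have SR h : h \in S3 -> R h \in S3.
    move=> hS; have := @face_word_mem_pred O (a :: S0) (R (R (R a))) S3 _ h.
    move=> /(_ _ W hS)[u uS e].
    have : R h \in R (R (R a)) :: S3.
      by rewrite e; case/predU1P: uS => [->|/c//]; rewrite inE m3 orbT.
    rewrite inE => /predU1P[/perm_inj eh|//].
    move: hS; rewrite eh => hS; exfalso.
    mem_twice (a :: S0 ++ R (R (R a)) :: S3) (R (R a) :: S2 ++ R a :: S1)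
      (R (R a)) us hS hS.
  apply: (@even_card_closed (fun h => R (R h)))  => // h hS.
  exact/SR/SR.
by rewrite !size_mem //= => ->.
Qed.

Lemma counterclockwise_rot O a S0 S1 S2 S3 (b := R a) :
    face_word O (a :: S0 ++ R a :: S1 ++ R (R a) :: S2 ++ R (R (R a)) :: S3) ->
  face_word O (b :: S1 ++ R b :: S2 ++ R (R b) :: S3 ++ R (R (R b)) :: S0).
Proof.
move=> W; rewrite /b !R4.
rotate_word (a :: S0) (R a :: S1 ++ R (R a) :: S2 ++ R (R (R a)) :: S3) W.
Qed.

Lemma counterclockwise_mem O a S0 S1 S2 S3 :
    face_word O (a :: S0 ++ R a :: S1 ++ R (R a) :: S2 ++ R (R (R a)) :: S3) ->
    O a != R (R a) ->
  exists S, S2 = rcons S (O a).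
Proof.
move=> W; rewrite -{1 3}[a]R4.
apply: (@face_word_pred O (a :: S0 ++ R a :: S1) (R (R a)) _ _ S3).
by move: W; rewrite ?catE.
Qed.

(** Without a loop here, the partners of [a], [R a] and [R (R (R a))] lie in [S2], [S3] and [S1], so
    no chord from [S0] ends at these corners. One that ends in [S0], [S1] or [S3] lies, after a
    suitable rotation of the word, in two consecutive arcs or in one. *)
Lemma counterclockwise_opposite O a S0 S1 S2 S3 p :
    face_word O (a :: S0 ++ R a :: S1 ++ R (R a) :: S2 ++ R (R (R a)) :: S3) ->
    O a != R (R a) -> O (R a) != R (R (R a)) ->
    p \in S0 ->
  O p \in R (R a) :: S2 \/ reach has_loop O.
Proof.
move=> W n0 n1 pS0; have [OK On us sT _] := W.
have W1 := counterclockwise_rot W; have W2 := counterclockwise_rot W1.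
have W3 := counterclockwise_rot W2.
have m2 : O a \in S2.
  by have [S ->] := counterclockwise_mem W n0; rewrite mem_rcons mem_head.
have m3 : O (R a) \in S3.
  by have [S ->] := counterclockwise_mem W1 n1; rewrite mem_rcons mem_head.
have m1 : O (R (R (R a))) \in S1.
  have [|S ->] := counterclockwise_mem W3; last by rewrite mem_rcons mem_head.
  by apply: contra n1; rewrite R4 => /eqP e; rewrite -{1}e OK.
have [|nOp] := boolP (O p \in R (R a) :: S2); [by left|right].
have : O p \in [:: a; R a; R (R (R a))] \/ O p \in S0 ++ S1 ++ S3.
  apply/orP; rewrite -mem_cat; move: (sT (O p)) nOp; rewrite !(inE, mem_cat).
  by do 4?case: (_ == _) => //=; do 4?case: (_ \in _) => //=.
case.
  rewrite !inE => /or3P[] /eqP e; exfalso; move: pS0; rewrite -[p]OK e => pS0.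
  - mem_twice (a :: S0) (R a :: S1 ++ R (R a) :: S2 ++ R (R (R a)) :: S3)
      (O a) us pS0 m2.
  - mem_twice (a :: S0) (R a :: S1 ++ R (R a) :: S2 ++ R (R (R a)) :: S3)
      (O (R a)) us pS0 m3.
  - mem_twice (a :: S0) (R a :: S1 ++ R (R a) :: S2 ++ R (R (R a)) :: S3)
      (O (R (R (R a)))) us pS0 m1.
rewrite !mem_cat => /or3P[] m.
- by apply: (counterclockwise_chord_reach_loop (p := p) W3); rewrite ?pS0 ?orbT.
- by apply: (counterclockwise_chord_reach_loop (p := p) W); rewrite ?pS0.
- by apply: (counterclockwise_chord_reach_loop (p := O p) W3); rewrite ?m ?OK.
Qed.

Lemma reach_loop_of_counterclockwise O a S0 S1 S2 S3 :
    face_word O (a :: S0 ++ R a :: S1 ++ R (R a) :: S2 ++ R (R (R a)) :: S3) ->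
  reach has_loop O.
Proof.
move=> W; have [OK On us _ _] := W.
have [e|n0] := eqVneq (O a) (R (R a)).
  by apply: reach_here; eexists; exists a; split; first exact: W.
have [e|n1] := eqVneq (O (R a)) (R (R (R a))).
  by apply: reach_here; eexists; exists (R a); split; first exact: W.
have W2 := counterclockwise_rot (counterclockwise_rot W).
have n2 : O (R (R a)) != R (R (R (R a))).
  by apply: contra n0; rewrite R4 => /eqP e; rewrite -{1}e OK.
have n3 : O (R (R (R a))) != R (R (R (R (R a)))).
  by apply: contra n1; rewrite R4 => /eqP e; rewrite -{1}e OK.
have [S e2] := counterclockwise_mem W n0.
have [S' e0] := counterclockwise_mem W2 n2.
(* The vertex of [h], which is also that of [O a], has its corners alternately
   on [S0] and [S2], so their order on the word is not cyclic. *)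
have [h [S0' e0']] : exists h S0', S0 = h :: S0'.
  by rewrite e0; case: S' {e0} => [|h S'] /=; do 2!eexists.
have Rh : R h = O a.
  have := @face_word_next O [::] a h.
  by move: W; rewrite e0' ?catE => W /(_ _ W).
have [hS2|//] : O h \in R (R a) :: S2 \/ reach has_loop O.
  by apply: (counterclockwise_opposite W); rewrite // e0' mem_head.
(* [R (R (R h))] comes right after [O h] on the word, and [O h] is not the last letter of [S2],
   which is [O a]. *)
have {}hS2 : R (R (R h)) \in S2.
  case: (@face_word_succ O (a :: S0 ++ R a :: S1) (R (R a)) S2
           (R (R (R a)) :: S3) (O h)) => //.
  - by move: W; rewrite ?catE.
  - rewrite e2 last_rcons (inj_eq perm_inj); apply/eqP => e.
    by move: us; rewrite e0' /= -e inE eqxx.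
  - by move=> w wS2; rewrite OK -{1}[h]R4 => /perm_inj <-.
have [hS0|//] : O (R (R (R h))) \in a :: S0 \/ reach has_loop O.
  by have := counterclockwise_opposite W2 n2 n3 hS2; rewrite !R4.
have {}hS0 : R (R h) \in S0'.
  case: (@face_word_succ O [::] a S0 (R a :: S1 ++ R (R a) :: S2
           ++ R (R (R a)) :: S3) (O (R (R (R h))))) => //.
  - rewrite (can2_eq OK OK) -(face_word_last W); apply/eqP => e.
    rewrite e in hS2.
    mem_twice (a :: S0 ++ R a :: S1 ++ [:: R (R a)]) (S2 ++ R (R (R a)) :: S3)
      (R (R a)) us hS2 hS2.
  - move=> w; rewrite OK e0' inE => wS0 /perm_inj ew; move: wS0.
    by rewrite ew (negPf (R2 h)).
have {}hS2 : R (R (R h)) \in S.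
  by move: hS2; rewrite e2 mem_rcons inE -Rh (negPf (R2 _)).
case/path.splitPr: hS0 e0' => X Y e0'; case/path.splitPr: hS2 e2 => Z U e2.
apply: (@reach_loop_mixed _ (R (R h)) (Y ++ R a :: S1 ++ R (R a) :: Z) U
  (R (R (R a)) :: S3 ++ [:: a]) X); rewrite !R4.
move: W; rewrite e0' e2 -Rh => W.
rotate_word (a :: h :: X) (R (R h) :: Y ++ R a :: S1 ++ R (R a) :: Z ++
  R (R (R h)) :: U ++ R h :: R (R (R a)) :: S3) W.
Qed.

(** Of the six orders in which the other corners can follow [a], four are mixed when read from a
    suitable corner, and two are cyclic. *)
Lemma reach_loop O s (a : T) : face_word O s -> reach has_loop O.
Proof.
move=> W0; have [{W0}s W] := face_word_from a W0; have [_ _ us sT _] := W.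
have R1 h : R h != h by apply: contra (R2 h) => /eqP e; rewrite !e.
have R3 h : R (R (R h)) != h.
  by apply: contra (R1 h) => /eqP e; rewrite -{1}e R4.
move: (sT (R a)) (sT (R (R a))) (sT (R (R (R a)))).
rewrite !inE (negPf (R1 a)) (negPf (R2 a)) (negPf (R3 a)) /=.
move=> {us sT}/path.splitPr e1; case: e1 W => X Y W.
rewrite !mem_cat !inE !(inj_eq perm_inj) (negPf (R1 _)) (negPf (R2 _)) /=.
case/orP=> /path.splitPr e2; case: e2 W => Z U W;
rewrite !(mem_cat, inE) !(inj_eq perm_inj) (negPf (R1 _)) /=.
- rewrite -orbA; case/or3P=> /path.splitPr e3; case: e3 W => V K W.
  + by apply: (@reach_loop_of_clockwise _ a V Y U K); move: W; rewrite ?catE.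
  + apply: (@reach_loop_mixed _ (R (R a)) V K Y Z); rewrite !R4.
    rotate_word (a :: Z) (R (R a) :: V ++ R (R (R a)) :: K ++ R a :: Y) W.
  + apply: (@reach_loop_mixed _ (R (R (R a))) K Z U V); rewrite !R4.
    rotate_word (a :: Z ++ R (R a) :: U ++ R a :: V) (R (R (R a)) :: K) W.
- case/or3P=> /path.splitPr e3; case: e3 W => V K W.
  + apply: (@reach_loop_mixed _ (R a) Z U V K); rewrite !R4.
    rotate_word (a :: V ++ R (R (R a)) :: K) (R a :: Z ++ R (R a) :: U) W.
  + by apply: (@reach_loop_mixed _ a X V K U); move: W; rewrite ?catE.
  + apply: (@reach_loop_of_counterclockwise _ a X Z V K).
    by move: W; rewrite ?catE.
Qed.

(** * From a loop to a torus summand *)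

Lemma face_word_cons O A u B h :
    face_word O (A ++ u :: B) -> R h = O u -> head u A != h ->
  exists B', B = h :: B'.
Proof.
move=> W e; case: B W => [|v B] W; last first.
  by exists B; rewrite -(face_word_next W) in e; move/perm_inj: e => ->.
case: A W => [|x A] /face_word_wrap; rewrite ?last_cat /= -e => /perm_inj ->.
  by rewrite eqxx.
by rewrite eqxx.
Qed.

(** The face word of a connected sum with the torus: [a] is the loop of the
    torus, and [c], [d] join its vertex to the vertex of the sum. *)
Definition has_torus_summand O : Prop :=
  exists c a d V, face_word O (c :: a :: O c :: d :: O a :: O d :: V).

(** Here [c] and [d] are the partners of [R a] and [R (R (R a))]. The rotation at the vertex of the
    loop dictates the neighbours of [a] and of [O a] on the word. *)
Lemma loop_face_word O s a :
    face_word O s -> O a = R (R a) -> 4 < #|T| ->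
  exists c d U V, face_word O (c :: a :: O c :: U ++ d :: O a :: O d :: V).
Proof.
move=> W0 loop; have [OK On _ _ _] := W0.
have R1 h : R h != h by apply: contra (R2 h) => /eqP e; rewrite !e.
have R3 h : R (R (R h)) != h.
  by apply: contra (R1 h) => /eqP e; rewrite -{1}e R4.
pose c := O (R a); pose d := O (R (R (R a))).
have Oc : O c = R a by rewrite OK.
have Od : O d = R (R (R a)) by rewrite OK.
have [s1 W1] := face_word_from c W0.
have ca : c != a by rewrite (can2_eq OK OK) loop (inj_eq perm_inj) eq_sym.
have [s2 e] := @face_word_cons O [::] c s1 a W1 (esym Oc) ca.
subst s1.
have [s3 e] := @face_word_cons O [:: c] a s2 (R a) W1 (esym loop) (On _).
subst s2.
have [_ _ us sT _] := W1.
have := sT d; rewrite !inE.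
have [/perm_inj/eqP|_ /=] := eqVneq d c; first by rewrite (negPf (R2 _)).
have [e|_ /=] := eqVneq d a.
  move: Od; rewrite e loop => /perm_inj/perm_inj/eqP.
  by rewrite eq_sym (negPf (R1 _)).
(* If [d = R a], both edges at the vertex are loops and the word closes up after four letters, which
   the bound on [#|T|] excludes. *)
have [dRa _ | dRa /=] := eqVneq d (R a).
  have cR : c = R (R (R a)) by rewrite /c -{1}dRa Od.
  have nc : c != R (R a) by rewrite cR R1.
  have [s4 e] := @face_word_cons O [:: c; a] (R a) s3 (R (R a)) W1 (esym cR) nc.
  subst s3; rewrite ltnNge => /negP[].
  rewrite -(eq_card sT : #|_| = #|T|) (card_uniqP us).
  case: s4 W1 us {sT} => [|h s4] // W1 us.
  have := @face_word_next O [:: c; a; R a] (R (R a)) h s4 W1.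
  rewrite -loop OK -{1}[a]R4 -cR => /perm_inj e.
  by rewrite -e /= !inE eqxx !orbT in us.
move=> ds3 _; case/path.splitPr: ds3 W1 {us sT} => U V W1.
have [||V1 e] := @face_word_cons O (c :: a :: R a :: U) d V (O a) W1.
- by rewrite loop Od.
- by rewrite /= (inj_eq perm_inj) R1.
subst V.
have [|||V e] :=
  @face_word_cons O (c :: a :: R a :: U ++ [:: d]) (O a) V1 (O d).
- by move: W1; rewrite ?catE.
- by rewrite Od OK R4.
- by rewrite /= Od (can2_eq OK OK) eq_sym.
subst V1; exists c, d, U, V; rewrite Oc.
exact: W1.
Qed.

(** Cutting open [y] and [d] exchanges [U] with the single letter [O a], and [y] takes over the role
    of [d]. *)
Lemma reach_slide_first O c a d y U U' V :
    face_word O (c :: a :: O c :: (y :: U ++ O y :: U') ++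
      d :: O a :: O d :: V) ->
  reach has_torus_summand O.
Proof.
move=> W; have [OK _ _ _ _] := W.
have {}W : face_word O (y :: U ++ O y :: U' ++ d :: [:: O a] ++ O d ::
    (V ++ [:: c; a; O c])).
  rotate_word [:: c; a; O c] (y :: U ++ O y :: U' ++ d :: O a :: O d :: V) W.
apply: (reach_face_word_cut W); apply: reach_here.
have [_ {}W ey _ eO] := face_word_cut W.
exists c, a, y, (U' ++ d :: U ++ O y :: V); rewrite ey !eO.
- rotate_word (y :: O a :: O d :: U' ++ d :: U ++ O y :: V) [:: c; a; O c] W.
- by rewrite !(mem_cat, inE) eqxx ?orbT.
- by rewrite !(mem_cat, inE) eqxx ?orbT.
Qed.

(** Cutting open [c] and [y] exchanges the single letter [a] with [U], and [y] takes over the role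
    of [c]. *)
Lemma reach_slide_last O c a d y U U' V :
    face_word O (c :: a :: O c :: (U' ++ y :: U ++ [:: O y]) ++
      d :: O a :: O d :: V) ->
  reach has_torus_summand O.
Proof.
move=> W; have [OK _ _ _ _] := W.
have {}W : face_word O (c :: [:: a] ++ O c :: U' ++ y :: U ++ O y ::
    d :: O a :: O d :: V).
  by move: W; rewrite ?catE.
apply: (reach_face_word_cut W); apply: reach_here.
have [_ {}W _ ey eO] := face_word_cut W.
exists y, a, d, (V ++ c :: U ++ O y :: U'); rewrite ey !eO.
- rotate_word (c :: U ++ O y :: U') (y :: a :: O c :: d :: O a :: O d :: V) W.
- by rewrite !(mem_cat, inE) eqxx ?orbT.
- by rewrite !(mem_cat, inE) eqxx ?orbT.
Qed.

(** The word is symmetric under exchanging [c, a, U] with [d, O a, V]. If neither the first letter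
    [e] of [U] nor the last letter [l] of [V] has its partner in its own arc, then [e], [c], [O l]
    are consecutive at one vertex, and its fourth half-edge [f] gives the missing chord. *)
Lemma reach_torus_summand_of_loop O c a d U V :
    face_word O (c :: a :: O c :: U ++ d :: O a :: O d :: V) ->
  reach has_torus_summand O.
Proof.
move=> W; have [OK On us sT _] := W.
have OUV p : p \in U \/ p \in V -> O p \in U ++ V.
  move=> pUV; suff : O p \notin [:: c; a; O c; d; O a; O d].
    have := sT (O p); rewrite !(inE, mem_cat).
    by do 6?case: (_ == _) => //=; do 2?case: (_ \in _) => //=.
  have q6 q : q \in [:: c; a; O c; d; O a; O d] ->
      O q \in [:: c; a; O c; d; O a; O d].
    by rewrite !inE => /or4P[|||/or3P[]] /eqP->; rewrite ?OK eqxx ?orbT.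
  apply/negP => /q6; rewrite OK => p6.
  have : uniq ([:: c; a; O c; d; O a; O d] ++ (U ++ V)).
    rewrite -(perm_uniq (s1 := c :: a :: O c :: U ++ d :: O a :: O d :: V)) //.
    by apply/seq.permP => f; rewrite /= !count_cat /=; ring.
  by move/uniq_cat_disjoint => /(_ p p6); apply; rewrite mem_cat; apply/orP.
case: U => [|e U] in W us sT OUV *.
  by apply: reach_here; exists c, a, d, V.
case/lastP: V => [|V l] in W us sT OUV *.
  apply: reach_here; exists d, (O a), c, (e :: U); rewrite OK.
  rotate_word (c :: a :: O c :: e :: U) [:: d; O a; O d] W.
have [|nOeU] := boolP (O e \in U).
  by move=> OeU; case/path.splitPr: OeU W => U1 U2; apply: reach_slide_first.
have [|nOlV] := boolP (O l \in V).
  move=> OlV; case/path.splitPr: OlV W => V1 V2 W.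
  apply: (@reach_slide_last O d (O a) c (O l) V2 V1 (e :: U)); rewrite !OK.
  rotate_word (c :: a :: O c :: e :: U)
    (d :: O a :: O d :: V1 ++ O l :: V2 ++ [:: l]) W.
have Re : R e = c.
  by rewrite -[c]OK; apply: (@face_word_next O [:: c; a] (O c) e _ W).
have Rc : R c = O l.
  by rewrite (face_word_wrap W) !(last_cat, last_cons, last_rcons).
have OlU : O l \in U.
  have : O l \in (e :: U) ++ rcons V l.
    by apply: OUV; rewrite mem_rcons mem_head; right.
  rewrite mem_cat mem_rcons !inE (negPf nOlV) (negPf (On _)) !orbF.
  by rewrite -Rc -Re (negPf (R2 _)).
have OeV : O e \in V.
  have : O e \in (e :: U) ++ rcons V l by apply: OUV; rewrite mem_head; left.
  rewrite mem_cat mem_rcons !inE (negPf nOeU) (negPf (On _)) /=.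
  by rewrite (can2_eq OK OK) -Rc -Re eq_sym (negPf (R2 _)).
(* Cutting open [c] and [e] brings [f] and its other side into the same arc. *)
case/path.splitPr: OeV W {us sT OUV nOlV} => V1 V2 W.
have [f [V3 eV]] : exists f V3, rcons V2 l = f :: V3.
  by case: V2 {W} => [|f V2] /=; do 2!eexists.
have {}W : face_word O (c :: [:: a] ++ O c :: [::] ++ e ::
    (U ++ d :: O a :: O d :: V1) ++ O e :: (f :: V3)).
  by rewrite -eV; move: W; rewrite ?catE.
have Rf : R f = e.
  rewrite -[e]OK; apply: (@face_word_next O (c :: a :: O c :: e :: U ++
    d :: O a :: O d :: V1) _ _ V3).
  by move: W; rewrite ?catE.
have OfU : O f \in U.
  have [] := @face_word_mem_pred O [:: c; a; O c] e U
    (d :: O a :: O d :: V1 ++ O e :: f :: V3) (O l) _ OlU.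
    by move: W; rewrite ?catE.
  move=> w wU; rewrite -Rc -Re -Rf R4 => fw; move: wU; rewrite fw OK inE.
  by case/predU1P=> // we; case/eqP: (opp_neq_rot f W); rewrite Rf fw OK.
apply: (reach_face_word_cut W).
have [_ {}W ec ee eO] := face_word_cut W.
have eOf : cut O c e f = O f by rewrite eO // !(mem_cat, inE) eqxx ?orbT.
case/path.splitPr: OfU W eO => U1 U2 W eO.
apply: (@reach_slide_first _ e a d f (V3 ++ c :: U1) U2 (V1 ++ [:: O e])).
rewrite ee eOf !eO; last 2 first.
- by rewrite !(mem_cat, inE) eqxx ?orbT.
- by rewrite !(mem_cat, inE) eqxx ?orbT.
rotate_word (c :: U1 ++ O f :: U2 ++ d :: O a :: O d :: V1 ++ [:: O e])
  (e :: a :: O c :: f :: V3) W.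
Qed.

Lemma reach_torus_summand O s (a : T) :
  4 < #|T| -> face_word O s -> reach has_torus_summand O.
Proof.
move=> T4 /(@reach_loop _ _ a)/reach_trans; apply=> {}O [{}s [h [W loop]]].
have [c [d [U [V W']]]] := loop_face_word W loop T4.
exact: reach_torus_summand_of_loop W'.
Qed.

End FaceWords.

(** * One-faced collections and their summands *)

Lemma card_porbits (T : finType) (s : {perm T}) k :
  (forall h, #|porbit s h| = k) -> #|porbits s| * k = #|T|.
Proof.
move=> sk; rewrite -[RHS]sum1_card (partition_big_imset (porbit s)) /=.
rewrite -sum_nat_const; apply: eq_bigr => A /imsetP[h _ ->].
by rewrite -(sk h) sum1_card; apply: eq_card => u; rewrite -eq_porbit_mem.
Qed.

Section Collections.
Implicit Types C : collection.

Lemma rotK4 C (h : C) : Defs.rot (Defs.rot (Defs.rot (Defs.rot h))) = h.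
Proof. by have := iter_porbit Defs.rot h; rewrite rot4. Qed.

Lemma rot2_neq C (h : C) : Defs.rot (Defs.rot h) != h.
Proof.
have := uniq_traject_porbit Defs.rot h.
by rewrite rot4 /= !inE !negb_or => /andP[/and3P[_ n _] _]; rewrite eq_sym.
Qed.

Lemma porbit_connect (T : finType) (s : {perm T}) u v :
  (v \in porbit s u) = fconnect s u v.
Proof.
apply/porbitP/idP => [[i ->]|/iter_findex <-].
  by rewrite permX fconnect_iter.
by eexists; rewrite permX.
Qed.

Lemma face_follows C (u v : C) :
  frel (face C) u v = follows Defs.rot Defs.opp u v.
Proof.
rewrite /follows /= /face permM -(inj_eq (@perm_inj _ Defs.rot)) permKV.
by rewrite eq_sym.
Qed.

Lemma one_faced_word C (h : C) :
  one_faced C -> exists s, face_word (@Defs.rot C) Defs.opp s.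
Proof.
move=> /eqP/cards1P[A eA]; exists (fingraph.orbit (face C) h); split.
- exact: oppK.
- exact: opp_neq.
- exact: fingraph.orbit_uniq.
- move=> k; rewrite -fconnect_orbit -porbit_connect -eq_porbit_mem.
  have inA u : porbit (face C) u = A.
    by apply/set1P; rewrite -eA; apply: imset_f.
  by rewrite !inA.
- rewrite -(eq_cycle (@face_follows C)).
  by apply: cycle_orbit; apply: perm_inj.
Qed.

Lemma word_one_faced C (h : C) s :
  face_word (@Defs.rot C) Defs.opp (h :: s) -> one_faced C.
Proof.
move=> [_ _ us sT]; rewrite -(eq_cycle (@face_follows C)) => cs.
apply/eqP/cards1P; exists (porbit (face C) h); apply/setP => A; rewrite inE.
apply/imsetP/eqP => [[k _ ->]|->]; last by exists h.
apply/eqP; rewrite eq_porbit_mem porbit_connect.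
by rewrite (fconnect_cycle cs) ?sT.
Qed.

(** With [n] half-edges there are [n / 4] vertices, [n / 2] edges and one face, so the genus can be
    tracked by counting half-edges. *)
Lemma one_faced_on_card g C :
  one_faced_on g C <-> one_faced C /\ #|C| + 4 = 8 * g.
Proof.
have V := card_porbits (@rot4 C).
have E : #|porbits (@Defs.opp C)| * 2 = #|C|.
  apply: card_porbits => h.
  have -> : porbit Defs.opp h = [set h; Defs.opp h].
    apply/setP => k; rewrite porbit_connect !inE.
    rewrite (@fconnect_cycle _ _ [:: h; Defs.opp h] _ h) ?inE ?eqxx //.
    by rewrite /= oppK !eqxx.
  by rewrite cards2 eq_sym opp_neq.
by split=> -[F]; rewrite ?F => e; split=> //; rewrite ?F; lia.
Qed.

Lemma homeomorphic_refl C : homeomorphic C C.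
Proof. by exists id; split; [exists id | | left]. Qed.

Lemma homeomorphic_sym C C' : homeomorphic C C' -> homeomorphic C' C.
Proof.
case=> f [[f' fK f'K] fo fr]; exists f'; split.
- by exists f.
- by move=> h; apply: (can_inj fK); rewrite fo !f'K.
- case: fr => fr; [left|right] => h; apply: (can_inj fK).
    by rewrite fr !f'K.
  rewrite f'K; apply: (@perm_inj _ Defs.rot^-1%g).
  by rewrite permK -fr permKV f'K.
Qed.

Lemma homeomorphic_trans C1 C2 C3 :
  homeomorphic C1 C2 -> homeomorphic C2 C3 -> homeomorphic C1 C3.
Proof.
case=> f [bf fo fr] [f' [bf' fo' fr']]; exists (f' \o f); split.
- exact: bij_comp.
- by move=> h; rewrite /= fo fo'.
have fV : {morph f' : h / Defs.rot h} -> {morph f' : h / (Defs.rot^-1)%g h}.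
  by move=> m h; apply: (@perm_inj _ Defs.rot); rewrite permKV -m permKV.
have fVV : (forall h, f' (Defs.rot h) = (Defs.rot^-1)%g (f' h)) ->
    forall h, f' ((Defs.rot^-1)%g h) = Defs.rot (f' h).
  by move=> m h; rewrite -[in RHS](permKV Defs.rot h) m permKV.
case: fr fr' => fr [fr'|fr']; [left|right|right|left] => h; rewrite /= fr.
- exact: fr'.
- exact: fr'.
- exact: fV.
- exact: fVV.
Qed.
End Collections.

(** * Splitting off a torus summand *)

Section Restriction.
Variables (C : collection) (O : {perm C}) (S : {pred C}).
Hypotheses (OK : involutive O) (On : forall h, O h != h).
Hypothesis rotS : forall h, (Defs.rot h \in S) = (h \in S).
Hypothesis oppS : forall h, (O h \in S) = (h \in S).

(** The pairing [O] need not be that of [C]: the summand is removed only after its ties to the rest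
    have been re-paired. *)
Definition outside : finType := {h : C | h \notin S}.

Lemma outside_rot_subproof (u : outside) : Defs.rot (val u) \notin S.
Proof. by rewrite rotS (valP u). Qed.

Lemma outside_opp_subproof (u : outside) : O (val u) \notin S.
Proof. by rewrite oppS (valP u). Qed.

Definition outside_rot_fun (u : outside) : outside :=
  Sub (Defs.rot (val u)) (outside_rot_subproof u).
Definition outside_opp_fun (u : outside) : outside :=
  Sub (O (val u)) (outside_opp_subproof u).

Lemma outside_rot_inj : injective outside_rot_fun.
Proof. by move=> u v /(congr1 val); rewrite !SubK => /perm_inj/val_inj. Qed.

Lemma outside_opp_inj : injective outside_opp_fun.
Proof. by move=> u v /(congr1 val); rewrite !SubK => /perm_inj/val_inj. Qed.

Definition outside_rot : {perm outside} := perm outside_rot_inj.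
Definition outside_opp : {perm outside} := perm outside_opp_inj.

Lemma val_outside_rot u : val (outside_rot u) = Defs.rot (val u).
Proof. by rewrite permE SubK. Qed.

Lemma val_outside_opp u : val (outside_opp u) = O (val u).
Proof. by rewrite permE SubK. Qed.

Lemma outside_rot4 u : #|porbit outside_rot u| = 4.
Proof.
apply: porbit4; first by apply: val_inj; rewrite !val_outside_rot rotK4.
by rewrite -(inj_eq val_inj) !val_outside_rot rot2_neq.
Qed.

Lemma outside_oppK : involutive outside_opp.
Proof. by move=> u; apply: val_inj; rewrite !val_outside_opp OK. Qed.

Lemma outside_opp_neq u : outside_opp u != u.
Proof. by rewrite -(inj_eq val_inj) val_outside_opp On. Qed.

Definition restriction : collection :=
  Collection outside_rot4 outside_oppK outside_opp_neq.

Lemma restriction_one_faced h s :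
    uniq (h :: s) -> (forall k, (k \in h :: s) = (k \notin S)) ->
    path.cycle (follows Defs.rot O) (h :: s) ->
  one_faced restriction.
Proof.
move=> us hsS cs; have [w ew] : exists w : seq outside, map val w = h :: s.
  exists (pmap insub (h :: s)); rewrite pmap_filter; last exact: insubK.
  apply/all_filterP/allP => k; rewrite hsS => kS.
  by rewrite /= insubT.
case: w ew => // u w ew; apply: (@word_one_faced restriction u w); split.
- exact: outside_oppK.
- exact: outside_opp_neq.
- by rewrite -(map_inj_uniq val_inj) ew.
- by move=> k; rewrite -(mem_map val_inj) ew hsS (valP k).
- move: cs; rewrite -ew cycle_map; apply: sub_cycle => k l.
  by rewrite /= /follows -(inj_eq val_inj) val_outside_rot val_outside_opp.
Qed.

End Restriction.

(** The eight half-edges to remove are the four of the torus, at the vertex of the loop [a], and the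
    four at the vertex of [c], which contraction of the arc creates in the sum. *)
Lemma torus_summand_decomposition C :
    has_torus_summand (@Defs.rot C) Defs.opp ->
  exists (C1 : collection) (x : C1) (y : torus_collection),
    [/\ one_faced C1, #|C| = #|C1| + 8 & homeomorphic C (connected_sum x y)].
Proof.
case=> c [a [d [V W]]]; have [OK On us sT _] := W.
set R := @Defs.rot C in W *; set O := @Defs.opp C in W OK On us sT *.
have R4 : forall h, R (R (R (R h))) = h := @rotK4 C.
have R2 : forall h, R (R h) != h := @rot2_neq C.
have R1 h : R h != h by apply: contra (R2 h) => /eqP e; rewrite !e.
have Ra : R a = O c by apply: (@face_word_next _ _ _ [::] _ _ _ W).
have ROc : R (O c) = O a by apply: (@face_word_next _ _ _ [:: c] _ _ _ W).
have Rd : R d = c.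
  by rewrite -[c]OK; apply: (@face_word_next _ _ _ [:: c; a] _ _ _ W).
have ROa : R (O a) = O d.
  by apply: (@face_word_next _ _ _ [:: c; a; O c] _ _ _ W).
have ROd : R (O d) = a.
  by rewrite -[RHS]OK; apply: (@face_word_next _ _ _ [:: c; a; O c; d] _ _ _ W).
pose v0 := R c; pose v1 := R v0.
have Rv1 : R v1 = d by rewrite /v1 /v0 -Rd R4.
(* [S] lists the vertex of [c] and then that of [a], each in the order of the rotation. The map [f]
   below reads it by index. *)
pose w := [:: O a; O d; a; O c]; pose s6 := [:: d, c & w].
pose S := [:: v0, v1 & s6].
have sE : perm_eq [:: c, a, O c, d, O a, O d & V] (s6 ++ V).
  by apply/seq.permP => f; rewrite /=; ring.
have us6 : uniq s6 by move: us; rewrite (perm_uniq sE) cat_uniq => /andP[].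
have wR h : (R h \in w) = (h \in w).
  have wR1 k : k \in w -> R k \in w.
    by rewrite !inE => /or4P[] /eqP->; rewrite ?ROa ?ROd ?Ra ?ROc eqxx ?orbT.
  by apply/idP/idP=> [/wR1/wR1/wR1|/wR1]; rewrite ?R4.
have cw : c \notin w by case/and3P: us6.
have v0w : v0 \notin w by rewrite wR.
have v1w : v1 \notin w by rewrite wR.
have v0s : v0 \notin s6.
  rewrite inE negb_or inE negb_or v0w R1 !andbT.
  by rewrite -Rv1 eq_sym; exact: R2.
have v1s : v1 \notin s6.
  by rewrite inE negb_or inE negb_or v1w -{1}Rv1 eq_sym R1 R2.
have uS : uniq S by rewrite /= inE negb_or eq_sym R1 v0s v1s; exact: us6.
have RS h : (R h \in S) = (h \in S).
  have RS1 k : k \in S -> R k \in S.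
    rewrite 4!inE => /or4P[/eqP->|/eqP->|/eqP->|/orP[/eqP->|]].
    - by rewrite !inE eqxx orbT.
    - by rewrite Rv1 !inE eqxx !orbT.
    - by rewrite Rd !inE eqxx !orbT.
    - by rewrite !inE eqxx.
    - by rewrite -wR => kw; rewrite 4!inE kw !orbT.
  by apply/idP/idP=> [/RS1/RS1/RS1|/RS1]; rewrite ?R4.
(* Besides the edge [x] of the summand, made of the far ends of the edges at
   [v0] and [v1], this pairs [v0] with [v1], so that the eight half-edges of
   [S] are closed under both permutations and can be removed. *)
pose P := cut O v0 (O v1).
have s6O k : (O k \in s6) = (k \in s6).
  have s61 l : l \in s6 -> O l \in s6.
    rewrite !inE => /orP[|/or4P[|||/orP[]]] /eqP->;
    by rewrite ?OK eqxx ?orbT.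
  by apply/idP/idP=> [/s61|/s61]; rewrite ?OK.
have v01 : O v1 != O v0 by rewrite (inj_eq perm_inj) R1.
have Pv0 : P v0 = v1 by rewrite /P cutL ?OK.
have PK : involutive P by apply: cutK.
have Pv1 : P v1 = v0 by rewrite -Pv0 PK.
have Po1 : P (O v1) = O v0 by rewrite /P cutR.
have Po0 : P (O v0) = O v1 by rewrite -Po1 PK.
have P6 k : k \in s6 -> P k = O k.
  move=> k6; apply: cut_id; rewrite OK !inE !negb_or.
  apply/and4P; split; apply: contraTneq k6 => ->; rewrite ?s6O //.
have PS h : (P h \in S) = (h \in S).
  have PS1 k : k \in S -> P k \in S.
    rewrite 2!inE => /or3P[/eqP->|/eqP->|k6].
    - by rewrite Pv0 !inE eqxx ?orbT.
    - by rewrite Pv1 !inE eqxx.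
    - by rewrite P6 // 2!inE s6O k6 !orbT.
  by apply/idP/idP=> [/PS1|/PS1]; rewrite ?PK.
have Pn : forall h, P h != h by apply: cut_neq.
have o0S : O v0 \notin S.
  by rewrite in_cons in_cons (negPf (On _)) (negPf (opp_neq_rot v0 W)) s6O.
have o1S : O v1 \notin S by rewrite -PS Po1.
have [||V1 eV] := @face_word_cons _ _ O [:: c; a; O c; d; O a] (O d) V v1 W.
- by rewrite OK.
- by apply: contraNneq v1s => <-; rewrite !inE eqxx orbT.
subst V; have : v0 \in V1.
  have := sT v0; rewrite (perm_mem sE) mem_cat (negPf v0s) inE.
  by rewrite eq_sym (negPf (R1 _)).
move=> v0V; case/path.splitPr: v0V W us sT sE => A0 B0 W us sT sE.
have [A eA] : exists A, A0 = rcons A (O v1).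
  by apply: (@face_word_pred _ R O [:: c; a; O c; d; O a; O d] v1 A0 v0 B0 W).
have [B eB] : exists B, B0 = rcons B (O v0).
  have := face_word_wrap W; rewrite -/v0 => e.
  case/lastP: B0 e {W us sT sE} => [|B l] /=;
    rewrite !(last_cat, last_cons, last_rcons) /=.
    by move/esym/eqP; rewrite (negPf (On _)).
  by move=> ->; exists B; rewrite OK.
(* The word ends with [v1 A (O v1) v0 B (O v0)]. Under [P], the letter [O v0] has the old partner of
   [v1], and [O v1] that of [v0], so they lead into [A] and [B]. *)
pose K := O v0 :: A ++ O v1 :: B.
have {}sE : perm_eq [:: c, a, O c, d, O a, O d, v1 & A0 ++ v0 :: B0] (S ++ K).
  apply/seq.permP => f; rewrite eA eB /K -!cats1 /= !count_cat /= !count_cat /=.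
  ring.
have uSK : uniq (S ++ K) by rewrite -(perm_uniq sE).
have KS k : (k \in K) = (k \notin S).
  have := sT k; rewrite (perm_mem sE) mem_cat.
  case kS : (k \in S) => //= _; apply/negP.
  exact: uniq_cat_disjoint uSK kS.
have uK : uniq K by move: uSK; rewrite cat_uniq => /and3P[].
have Pid k : k \notin S -> k != O v0 -> k != O v1 -> P k = O k.
  rewrite 2!in_cons !negb_or => /and3P[k0 k1 _] ko0 ko1; apply: cut_id.
  by rewrite OK !inE !negb_or k0 k1 ko0 ko1.
have PAB k : k \in A ++ B -> P k = O k.
  move=> kAB; have : uniq ([:: O v0; O v1] ++ (A ++ B)).
    rewrite -(perm_uniq (s1 := K)) //; apply/seq.permP => f.
    by rewrite /K /= !count_cat /=; ring.
  move=> uAB; apply: Pid.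
  - rewrite -KS /K in_cons mem_cat in_cons.
    by move: kAB; rewrite mem_cat => /orP[] ->; rewrite !orbT.
  - by apply/negP => /eqP e; apply: (uniq_cat_disjoint uAB _ kAB);
      rewrite e !inE eqxx.
  - by apply/negP => /eqP e; apply: (uniq_cat_disjoint uAB _ kAB);
      rewrite e !inE eqxx orbT.
have cK : path.cycle (follows R P) K.
  have [cA cB] : path (follows R O) v1 (rcons A (O v1)) /\
                 path (follows R O) v0 (rcons B (O v0)).
    have [_ _ _ _] := W; rewrite eA eB /=; do 6!case/andP=> _.
    rewrite rcons_cat cat_path /= (rcons_path _ v0).
    by case/and3P=> cA _ /andP[cB _].
  rewrite /K /= rcons_cat /= -cat_rcons cat_path last_rcons.
  rewrite (@eq_arc _ R O _ v1) ?cA //=.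
    rewrite (@eq_arc _ R O _ v0) // => k kB.
    by apply: PAB; rewrite mem_cat kB orbT.
  by move=> k kA; apply: PAB; rewrite mem_cat kA.
pose C1 := restriction (S := mem S) PK Pn RS PS.
have F1 : one_faced C1 by apply: restriction_one_faced uK KS cK.
have card1 : #|C1| + 8 = #|C|.
  rewrite card_sig -[RHS](cardC (mem S)) addnC; congr (_ + _).
  by rewrite (card_uniqP uS).
pose x : C1 := Sub (O v0) o0S.
(* Index 1 is the place of [O d] in [w]; its opposite, index 3, is that of [O c]. *)
pose y : torus_collection := Ordinal (isT : 1 < 4).
exists C1, x, y; split=> //; apply: homeomorphic_sym.
pose f (h : connected_sum x y) : C :=
  match h with
  | inl (inl u) => val u
  | inl (inr i) => nth a S (4 + i)
  | inr i => nth a S i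
  end.
have fI : injective f.
  have nS n : n < 8 -> nth a S n \in S by move=> n8; rewrite mem_nth.
  have Sn (u : C1) n : n < 8 -> val u <> nth a S n.
    by move=> /nS nu e; have := valP u; rewrite /= e nu.
  have i8 (i : 'I_4) : i < 8 /\ 4 + i < 8 by case: i => -[|[|[|[|//]]]].
  have inj n m : n < 8 -> m < 8 -> nth a S n = nth a S m -> n = m.
    by move=> n8 m8 /eqP; rewrite nth_uniq // => /eqP.
  move=> [[u|i]|i] [[v|j]|j] /= e.
  - by congr (inl (inl _)); apply: val_inj.
  - by case: (Sn u (4 + j) (i8 j).2).
  - by case: (Sn u j (i8 j).1).
  - by case: (Sn v (4 + i) (i8 i).2).
  - congr (inl (inr _)); apply/val_inj/(@addnI 4).
    exact: (inj _ _ (i8 i).2 (i8 j).2 e).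
  - have := inj _ _ (i8 i).2 (i8 j).1 e.
    by move=> {}e; have := ltn_ord j; rewrite -e.
  - by case: (Sn v i (i8 i).1).
  - have := inj _ _ (i8 i).1 (i8 j).2 e.
    by move=> {}e; have := ltn_ord i; rewrite e.
  - congr inr; apply: val_inj; exact: (inj _ _ (i8 i).1 (i8 j).1 e).
exists f; split; last left.
- by apply: inj_card_bij; rewrite // -card1 !card_sum !card_ord -addnA.
- case=> [[u|i]|i]; rewrite [LHS]/f permE /=.
  + case: ifP => [/eqP ->|ux]; first by rewrite inordK /= ?OK.
    case: ifP => [/eqP ->|uox].
      by rewrite inordK //= permE /= Po0 OK.
    rewrite val_outside_opp Pid //.
    * exact: (valP u).
    * by apply/negP => /eqP e; case/eqP: ux; apply: val_inj.
    * apply/negP => /eqP e; case/eqP: uox; apply: val_inj.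
      by rewrite val_outside_opp /= Po0.
  + have oppy : Defs.opp y = Ordinal (isT : 3 < 4).
      by apply: val_inj; rewrite /= permE.
    rewrite oppy; case: i => -[|[|[|[|//]]]] lti /=;
      rewrite ?inordK //= ?permE /=;
      by rewrite -/O ?OK.
  + rewrite (tnth_nth (inr ord0)); case: i => -[|[|[|[|//]]]] lti //=.
      by rewrite val_outside_opp /= Po0.
    by rewrite permE.
- case=> [[u|i]|i]; rewrite [LHS]/f permE /=.
  + by rewrite val_outside_rot.
  + rewrite permE; case: i => -[|[|[|[|//]]]] lti /=;
      by rewrite -/R ?(ROa, ROd, Ra, ROc).
  + by case: i => -[|[|[|[|//]]]] lti /=; rewrite -/R ?(Rv1, Rd).
Qed.

(** * The torus and the homeomorphism classes *)

Implicit Types C : collection.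

(** Four half-edges form a single vertex, and with a single face the partner of [h] is neither of
    its neighbours there. *)
Lemma opp_eq_rot2 C (h : C) :
  one_faced C -> #|C| = 4 -> Defs.opp h = Defs.rot (Defs.rot h).
Proof.
move=> F C4; have [s W] := one_faced_word h F.
have : Defs.opp h \in porbit Defs.rot h.
  have /eqP -> : porbit Defs.rot h == setT; last by rewrite inE.
  by rewrite eqEcard subsetT cardsT rot4 C4.
rewrite porbit_traject rot4 !inE (negPf (opp_neq h)).
rewrite (negPf (opp_neq_rot h W)) /=.
case/orP=> /= [/eqP//|/eqP e]; have /eqP[] := opp_neq_rot (Defs.opp h) W.
by rewrite oppK e rotK4.
Qed.

Lemma homeomorphic_torus C :
  one_faced C -> #|C| = 4 -> homeomorphic torus_collection C.
Proof.
move=> F C4; have [h _] : exists h : C, h \in C.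
  by apply/card_gt0P; rewrite C4.
have oppE := opp_eq_rot2 _ F C4.
pose f (i : torus_collection) := iter i Defs.rot h.
have R4 := rotK4 h; exists f; split; last left.
- apply: inj_card_bij; last by rewrite C4 card_ord.
  move=> i j; have := uniq_traject_porbit Defs.rot h; rewrite rot4 => u.
  have fE (k : torus_collection) : f k = nth h (traject Defs.rot h 4) k.
    by rewrite nth_traject.
  move/eqP; rewrite !fE nth_uniq ?size_traject ?ltn_ord // => /eqP.
  exact: val_inj.
- by case=> -[|[|[|[|//]]]] lti; rewrite [LHS]/f [RHS]oppE permE /= ?R4.
- by case=> -[|[|[|[|//]]]] lti; rewrite [LHS]/f permE /= ?R4.
Qed.

Lemma torus_one_faced : one_faced torus_collection.
Proof.
pose i k (lt_k : k < 4) : torus_collection := Ordinal lt_k.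
apply: (@word_one_faced _ (@i 0 isT) [:: @i 1 isT; @i 2 isT; @i 3 isT]).
split=> //.
- exact: torus_oppK.
- exact: torus_opp_neq.
- by case=> -[|[|[|[|//]]]].
- by rewrite /= /follows !permE.
Qed.

Lemma torus_genus : one_faced_on 1 torus_collection.
Proof.
by apply/one_faced_on_card; split; [exact: torus_one_faced | rewrite card_ord].
Qed.

Definition class_of g C (H : one_faced_on g C) : homeo_class g :=
  exist _ (homeomorphic C) (ex_intro _ C (conj H erefl)).

Lemma class_ofP g (u : homeo_class g) :
  exists C (H : one_faced_on g C), u = class_of H.
Proof. by case: u => c [C [H e]]; subst c; exists C, H. Qed.

Lemma eq_class_of g C C' (H : one_faced_on g C) (H' : one_faced_on g C') :
  homeomorphic C C' -> class_of H = class_of H'.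
Proof.
move=> hCC'; rewrite /class_of; move: (ex_intro _ C _) (ex_intro _ C' _).
have -> : homeomorphic C = homeomorphic C'.
  apply: functional_extensionality => D; apply: propositional_extensionality.
  by split; apply: homeomorphic_trans => //; apply: homeomorphic_sym.
by move=> p q; rewrite (proof_irrelevance _ p q).
Qed.

(** * The surgery-sum graph *)

Section Connectivity.
Variable g : nat.
Notation conn := (clos_refl_trans (hatK_vertex g) (@hatK_adj g)).

Lemma conn_sym u v : conn u v -> conn v u.
Proof.
elim=> [{}u {}v uv|{}u|{}u w {}v _ uw _ wv].
- exact/rt_step/hatK_adj_sym.
- exact: rt_refl.
- exact: rt_trans wv uw.
Qed.

Definition node (i : 'I_g) (u : homeo_class i.+1) : hatK_vertex g :=
  existT (fun j : 'I_g => vertex (surgery_graph j.+1)) i u.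

Lemma conn_cut_open (i : 'I_g) C (x y : C) (H : one_faced_on i.+1 C)
    (H' : one_faced_on i.+1 (cut_open x y)) :
  is_surgery x y -> conn (node (class_of H)) (node (class_of H')).
Proof.
(* A surgery may give back the same class, where the graph has no edge. *)
move=> xy; case: (classic (class_of H = class_of H')) => [->|neq].
  exact: rt_refl.
apply/rt_step/hatK_surgery; split=> //; left; exists C, x, y.
by split=> //; apply: homeomorphic_refl.
Qed.

(** Each cut of the pairing is a surgery on the collection that it defines, and the genus stays
    because the half-edges do. *)
Lemma conn_reach (i : 'I_g) (T : finType) (R O : {perm T})
    (R4 : forall h, #|porbit R h| = 4) (OK : involutive O)
    (On : forall h, O h != h) (H : one_faced_on i.+1 (Collection R4 OK On)) :
    reach R (has_torus_summand R) O ->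
  exists C (H' : one_faced_on i.+1 C),
    has_torus_summand (@Defs.rot C) Defs.opp /\
    conn (node (class_of H)) (node (class_of H')).
Proof.
move=> rO; elim: rO OK On H => {O} [O sO|O x y nyx nyox [s W] _ IH] OK On H.
  by exists (Collection R4 OK On), H; split=> //; apply: rt_refl.
pose C := Collection R4 OK On.
have F : one_faced (@cut_open C x y).
  have [s' W'] := face_word_from x W.
  exact: (@word_one_faced (@cut_open C x y) x s' W').
have H1 : one_faced_on i.+1 (@cut_open C x y).
  by apply/one_faced_on_card; split=> //; case/one_faced_on_card: H.
have [C' [H' [sC' c]]] := IH _ _ H1.
exists C', H'; split=> //; apply: rt_trans c.
by apply: conn_cut_open; split.
Qed.

Lemma conn_torus (lt0g : 0 < g) (i : 'I_g) (u : homeo_class i.+1) :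
  conn (node u) (@node (Ordinal lt0g) (class_of torus_genus)).
Proof.
elim: {i}(val i) {-2}i (erefl (val i)) u => [|k IH] i ei u.
  have e : i = Ordinal lt0g by apply: val_inj.
  subst i; have [C [H ->]] := class_ofP u.
  rewrite (eq_class_of H torus_genus); first exact: rt_refl.
  apply/homeomorphic_sym; case/one_faced_on_card: (H) => F C4.
  by apply: homeomorphic_torus => //; apply: (@addIn 4); rewrite C4.
have [C [H ->]] := class_ofP u.
have [F cardC] := (one_faced_on_card _ _).1 H.
have C4 : 4 < #|C| by rewrite ei in cardC; lia.
have [h _] : exists h : C, h \in C by apply/card_gt0P/(leq_trans _ C4).
have [s W] := one_faced_word h F.
have := reach_torus_summand (@rotK4 C) (@rot2_neq C) h C4 W.
case: C H F cardC C4 h s {W} => T R O R4 OK On H F cardC C4 h s.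
case/(conn_reach H) => C' [H' [sC' c]]; apply: rt_trans c _.
have [C1 [x [y [F1 card1 hom]]]] := torus_summand_decomposition sC'.
have lt_kg : k < g by have := ltn_ord i; rewrite ei => /ltnW.
(* Removing eight half-edges lowers the genus by one. *)
have H1 : one_faced_on (Ordinal lt_kg).+1 C1.
  apply/one_faced_on_card; split=> //=.
  have [_] := (one_faced_on_card _ _).1 H'; rewrite card1 ei => card2.
  by apply: (@addIn 8); rewrite addnAC card2; lia.
apply: rt_trans (IH (Ordinal lt_kg) erefl (class_of H1)).
apply/rt_step/hatK_sum_sym; first exact: ei.
by exists C1, x, y; split; first exact: homeomorphic_refl.
Qed.

End Connectivity.

Theorem theorem2 (g : nat) (hg : 1 <= g) : connected (surgery_sum_graph g).
Proof.
split.
  by constructor; exact: (@node g (Ordinal hg) (class_of torus_genus)).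
move=> [i u] [j v]; apply: rt_trans (conn_torus hg u) _.
exact/conn_sym/conn_torus.
Qed.
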